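(* Let $X$, $\xi\colon S\to\mathbb C^1$, $b\colon\mathbb C^{k+1}\to S$, $U'\subseteq U\subseteq X$, the ideal $I$, and the section $v$ of $\Theta_{\mathbb C^{1+n}}|_{U'}$ be as in the context. For each $g\in I$ let $g^\circ\in\mathbb C[\xi,\check x_1,\dots,\check x_n]$ be the image of $g$ under the natural embedding $\mathbb C[\check x_1,\dots,\check x_n]\hookrightarrow\mathbb C[\xi,\check x_1,\dots,\check x_n]$, and set $\mu(g)=dg^\circ(v)$, a rational function on $X$ defined on $U'$. Then: (1) for each $g\in I$, $\mu(g)$ is a regular function on the whole of $X$; (2) $\mu$ is a well-defined $\mathbb C[X]$-linear morphism $I/I^2\to\mathbb C[X]$; (3) $\mu$ represents in $T^1(X)$ the first order deformation $\varepsilon\colon\widetilde S\to\mathrm{Spec}\,\mathbb C[\varepsilon]/\varepsilon^2$ obtained by restricting $\xi\colon S\to\mathbb C^1$ to the double point at the origin of $\mathbb C^1$ corresponding to the tangent vector $\partial/\partial\xi$.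
   Context: Setting. $X$ is a normal affine variety over $\mathbb C$ and $\xi\colon S\to\mathbb C^1$ is a deformation of $X$ over the affine line: $S$ is a variety, $\xi$ is flat, and the scheme-theoretic fiber $\xi^{-1}(0)$ is $X$. $S$ is a closed subvariety of a vector space $\mathbb C^{1+n}$ with coordinates $\xi,\check x_1,\dots,\check x_n$ (the first coordinate restricting to the function $\xi$ on $S$); denote by $x_i\in\mathbb C[S]$ the restriction of $\check x_i$. Thus $X\subset\{\xi=0\}=\mathbb C^n$; let $I\subset\mathbb C[\check x_1,\dots,\check x_n]$ be its ideal, $\mathbb C[X]=\mathbb C[\check x_1,\dots,\check x_n]/I$. Moreover $b\colon\mathbb C^{k+1}\to S$ is a dominant morphism from the affine space with coordinates $y_0,\dots,y_k$ such that: (i) $\xi\circ b=y_0$; (ii) the restriction of $b$ to the hyperplane $\{y_0=0\}$ is a dominant morphism to $X$; (iii) this restriction maps $\{y_0=0\}$ birationally to $X$. $U\subseteq X$ is a smooth open subset with $\mathrm{codim}_X(X\setminus U)\ge2$, and $U'\subseteq U$ is a (nonempty) open subset on which $(b|_{y_0=0})^{-1}$ is defined. The section $v$ of $\Theta_{\mathbb C^{1+n}}|_{U'}$ ($\Theta$ = tangent sheaf) is $v(x)=d_{(b|_{y_0=0})^{-1}(x)}b\,(\partial/\partial y_0)$ for $x\in U'$. First order deformations and $T^1$. $T^1(X)$ is the cokernel of the map $\phi$ from $\mathrm{Der}\,\mathbb C[\check x_1,\dots,\check x_n]$ to $\mathrm{Hom}_{\mathbb C[X]}(I/I^2,\mathbb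 C[X])$ sending $\sum g_i\partial/\partial\check x_i$ to $g\mapsto\sum g_i\,\partial g/\partial\check x_i\bmod I$. Given a deformation $\widetilde S=\mathrm{Spec}\,B$ of $X$ over $\mathrm{Spec}\,\mathbb C[\varepsilon]/\varepsilon^2$ and lifts $\widetilde x_i\in B$ of the generators $x_i|_X$ of $\mathbb C[X]=B/\varepsilon B$, for every $g\in I$ there is $g'\in\mathbb C[\check x_1,\dots,\check x_n]$, unique modulo $I$, with $g(\widetilde x_1,\dots,\widetilde x_n)=\varepsilon g'(\widetilde x_1,\dots,\widetilde x_n)$ in $B$; the class in $T^1(X)$ of the resulting map $I/I^2\to\mathbb C[X]$, $g\mapsto g'\bmod I$, represents the deformation. *)

(* Defs.v *)
(* Classical affine algebraic geometry over an algebraically closed field K,  *)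
(* on top of multinomials.  A variety is an irreducible Zariski closed subset *)
(* of an affine space; its coordinate ring is the quotient of the polynomial  *)
(* ring by the ideal of all polynomials vanishing on it.                      *)
From HB Require Import structures.
From mathcomp Require Import all_boot all_order all_algebra.
From mathcomp Require Import boolp classical_sets.
From mathcomp Require Import mpoly.

Set Implicit Arguments.
Unset Strict Implicit.
Unset Printing Implicit Defensive.

Import GRing.Theory.

Local Open Scope classical_set_scope.
Local Open Scope quotient_scope.
Local Open Scope ring_scope.

Definition apoint (K : Type) (n : nat) := 'I_n -> K.

Definition pcons (K : Type) n (t : K) (x : apoint K n) : apoint K n.+1 :=
  fun i => oapp x t (unlift ord0 i).

Definition ptail (K : Type) n (z : apoint K n.+1) : apoint K n :=
  fun i => z (lift ord0 i).

Section Zariski.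
Variables (K : closedFieldType).

Definition zeros n (P : set {mpoly K[n]}) : set (apoint K n) :=
  [set x | forall p, P p -> p.@[x] = 0].

Definition zclosed n (Z : set (apoint K n)) := exists P, Z = zeros P.

Definition zopen_in n (X W : set (apoint K n)) :=
  exists2 Z, zclosed Z & W = X `\` Z.

Definition zclosure n (A : set (apoint K n)) : set (apoint K n) :=
  [set x | forall Z, zclosed Z -> A `<=` Z -> Z x].

Definition irreducible_closed n (Z : set (apoint K n)) :=
  [/\ zclosed Z, Z !=set0 &
      forall Z1 Z2, zclosed Z1 -> zclosed Z2 -> Z = Z1 `|` Z2 ->
        Z = Z1 \/ Z = Z2].

(* [c 0 < c 1 < ... < c d] is a strict chain of irreducible closed sets *)
Definition irreducible_chain n (d : nat) (c : nat -> set (apoint K n)) :=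
  (forall i, (i <= d)%N -> irreducible_closed (c i)) /\
  (forall i, (i < d)%N -> c i `<` c i.+1).

Definition has_dim n (X : set (apoint K n)) (d : nat) :=
  (exists2 c, irreducible_chain d c & c d `<=` X) /\
  (forall e c, irreducible_chain e c -> c e `<=` X -> (e <= d)%N).

(* The codimension in the irreducible set X of the closed set Z is at least d *)
(* when every irreducible closed subset of Z starts a chain of length d in X; *)
(* the empty set has infinite codimension.                                    *)
Definition codim_ge n (X Z : set (apoint K n)) (d : nat) :=
  forall Y, irreducible_closed Y -> Y `<=` Z ->
  exists2 c, irreducible_chain d c & c 0%N = Y /\ c d `<=` X.

Definition regular_on n (W : set (apoint K n)) (h : apoint K n -> K) :=
  forall x, W x ->
  exists2 O, zopen_in W O /\ O x &
  exists p q : {mpoly K[n]},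
    forall z, O z -> q.@[z] != 0 /\ h z = p.@[z] / q.@[z].

Definition dominant m n (A : set (apoint K m)) (f : apoint K m -> apoint K n)
    (Y : set (apoint K n)) :=
  f @` A `<=` Y /\ Y `<=` zclosure (f @` A).

Definition poly_map m n (b : n.-tuple {mpoly K[m]}) (y : apoint K m) :
    apoint K n :=
  fun i => (tnth b i).@[y].

(* For a dominant morphism f : A -> Y of irreducible varieties, the rational  *)
(* inverse of f exists and is defined on the nonempty open subset W of Y,     *)
(* where it is given by g.                                                    *)
Definition inverse_on m n (A : set (apoint K m)) (f : apoint K m -> apoint K n)
    (Y W : set (apoint K n)) (g : apoint K n -> apoint K m) :=
  [/\ zopen_in Y W, W !=set0, forall i, regular_on W (fun x => g x i),
      forall x, W x -> A (g x) /\ f (g x) = x &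
      forall y, A y -> W (f y) -> g (f y) = y].

Definition birational m n (A : set (apoint K m)) (f : apoint K m -> apoint K n)
    (Y : set (apoint K n)) :=
  exists W g, inverse_on A f Y W g.

Structure variety n := Variety {
  carrier :> set (apoint K n);
  carrierP : irreducible_closed carrier }.

(* the ideal I(X) *)
Definition vanishing n (X : variety n) : {pred {mpoly K[n]}} :=
  fun p => `[< forall x, carrier X x -> p.@[x] = 0 >].

Section CoordinateRing.
Variables (n : nat) (X : variety n).

Lemma vanishingP p :
  reflect (forall x, carrier X x -> p.@[x] = 0) (p \in vanishing X).
Proof. exact: asboolP. Qed.

Lemma vanishing_idealr : idealr_closed (vanishing X).
Proof.
have [_ [x Xx] _] := carrierP X; split.
- by apply/vanishingP => y _; rewrite meval0.
- by apply/vanishingP => /(_ x Xx) /eqP; rewrite meval1 oner_eq0.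
- move=> a u v /vanishingP u0 /vanishingP v0; apply/vanishingP => y Xy.
  by rewrite mevalD mevalM u0 // v0 // mulr0 addr0.
Qed.

Lemma vanishing_prime : prime_idealr_closed (vanishing X).
Proof.
have [[P XP] _ Xirr] := carrierP X.
have closedI p : zclosed (X `&` [set x | p.@[x] = 0]).
  exists (P `|` [set p]); apply/seteqP; split=> x /=.
    by rewrite XP => -[xP xp] q [/xP //|->].
  by rewrite XP => xPp; split=> [q Pq|]; apply: xPp; [left|right].
move=> u v /vanishingP uv0.
have /Xirr[]// : X = (X `&` [set x | u.@[x] = 0])
                     `|` (X `&` [set x | v.@[x] = 0]) :> set _.
  apply/seteqP; split=> [x Xx|x [[]|[]]//].
  have /eqP := uv0 x Xx; rewrite mevalM mulf_eq0.
  by case/orP => /eqP ?; [left|right].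
- by move=> XE; apply/orP; left; apply/vanishingP => x; rewrite XE => -[].
- by move=> XE; apply/orP; right; apply/vanishingP => x; rewrite XE => -[].
Qed.

HB.instance Definition _ := isIdealr.Build _ (vanishing X) vanishing_idealr.
HB.instance Definition _ :=
  isPrimeIdealrClosed.Build _ (vanishing X) vanishing_prime.

Definition coord_ring := {ideal_quot (vanishing X)}.
HB.instance Definition _ := GRing.ComNzRing.on coord_ring.
HB.instance Definition _ := NzRingQuotient.on coord_ring.

Definition coord_unit : {pred coord_ring} := fun f => `[< exists g, g * f = 1 >].
Definition coord_inv (f : coord_ring) : coord_ring :=
  if pselect (exists g, g * f = 1) is left fP then projT1 (cid fP) else f.

Fact coord_mulVf : {in coord_unit, left_inverse 1 coord_inv *%R}.
Proof.
move=> f /asboolP fP; rewrite /coord_inv; case: pselect => // fP'.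
exact: projT2 (cid fP').
Qed.

Fact coord_unitP f g : g * f = 1 -> coord_unit f.
Proof. by move=> gf; apply/asboolP; exists g. Qed.

Fact coord_inv_out : {in [predC coord_unit], coord_inv =1 id}.
Proof.
move=> f; rewrite inE => /negP fN; rewrite /coord_inv.
by case: pselect => // fP; case: fN; apply/asboolP.
Qed.

HB.instance Definition _ := GRing.ComNzRing_hasMulInverse.Build coord_ring
  coord_mulVf coord_unitP coord_inv_out.

Fact coord_mulf_eq0 (f g : coord_ring) : f * g = 0 -> (f == 0) || (g == 0).
Proof. exact: Quotient.rquot_IdomainAxiom. Qed.

HB.instance Definition _ :=
  GRing.ComUnitRing_isIntegral.Build coord_ring coord_mulf_eq0.

Definition rclass (p : {mpoly K[n]}) : coord_ring := \pi_coord_ring p.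
HB.instance Definition _ := GRing.RMorphism.copy rclass (\pi_coord_ring).

Lemma rclass_eq p q :
  (rclass p = rclass q) <-> (forall x, carrier X x -> p.@[x] = q.@[x]).
Proof.
have -> : (rclass p = rclass q) <-> (p - q \in vanishing X).
  by rewrite Quotient.idealrBE; split=> [?|/eqP]; first exact/eqP.
split=> [/vanishingP pq x Xx|pq].
  by apply/eqP; rewrite -subr_eq0 -mevalB pq.
by apply/vanishingP => x Xx; rewrite mevalB pq // subrr.
Qed.

(* the value of f at a point of X; arbitrary outside X *)
Definition reval (f : coord_ring) (x : apoint K n) : K := (repr f).@[x].

Lemma reval_rclass p x : carrier X x -> reval (rclass p) x = p.@[x].
Proof. by move=> Xx; apply: (rclass_eq _ _).1 x Xx; rewrite /rclass reprK. Qed.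

Definition normal :=
  forall z : {fraction coord_ring},
    integralOver (@tofrac coord_ring) z -> exists f, z = tofrac f.

Definition zariski_tangent (x : apoint K n) : set 'rV[K]_n :=
  [set w | forall p, p \in vanishing X ->
           \sum_(i < n) (p^`M(i)).@[x] * w 0 i = 0].

Definition smooth_at (x : apoint K n) :=
  exists2 V : {vspace 'rV[K]_n},
    (forall w, w \in V <-> zariski_tangent x w) & has_dim X (\dim V).

(* the coordinate ring module I/I^2 *)
Definition ideal_elt := {p : {mpoly K[n]} | p \in vanishing X}.
HB.instance Definition _ := SubChoice.on ideal_elt.
HB.instance Definition _ := [SubChoice_isSubZmodule of ideal_elt by <:].

Definition in_ideal_square : {pred ideal_elt} := fun u =>
  `[< exists s : seq (ideal_elt * ideal_elt),
        val u = \sum_(ab <- s) val ab.1 * val ab.2 >].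

Lemma in_ideal_squareP u :
  reflect (exists s : seq (ideal_elt * ideal_elt),
             val u = \sum_(ab <- s) val ab.1 * val ab.2)
          (u \in in_ideal_square).
Proof. exact: asboolP. Qed.

Fact ideal_square_zmod : zmod_closed in_ideal_square.
Proof.
split=> [|u v /in_ideal_squareP[s us] /in_ideal_squareP[t vt]].
  by apply/in_ideal_squareP; exists [::]; rewrite big_nil.
apply/in_ideal_squareP; exists (s ++ [seq (- ab.1, ab.2) | ab <- t]).
rewrite raddfB /= us vt big_cat big_map /= -sumrN; congr (_ + _).
by apply: eq_bigr => ab _; rewrite mulNr.
Qed.
HB.instance Definition _ :=
  GRing.isZmodClosed.Build _ in_ideal_square ideal_square_zmod.

Definition conormal := Quotient.quot in_ideal_square.
HB.instance Definition _ := GRing.Zmodule.on conormal.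
HB.instance Definition _ := ZmodQuotient.on conormal.

Definition cclass (u : ideal_elt) : conormal := \pi_conormal u.
HB.instance Definition _ := GRing.Additive.copy cclass (\pi_conormal).

Definition ideal_scale (p : {mpoly K[n]}) (u : ideal_elt) : ideal_elt :=
  Sub (p * val u) (idealMr p (valP u)).

Definition conormal_scale (f : coord_ring) (m : conormal) : conormal :=
  cclass (ideal_scale (repr f) (repr m)).

Lemma cclass_eq u v : cclass u = cclass v <-> (u - v \in in_ideal_square).
Proof. by rewrite Quotient.idealrBE; split=> [?|/eqP]; first exact/eqP. Qed.

Lemma conormal_scaleE p u :
  conormal_scale (rclass p) (cclass u) = cclass (ideal_scale p u).
Proof.
apply/cclass_eq/in_ideal_squareP.
set p' := repr _; set u' := repr _.
have pp : p' - p \in vanishing X.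
  by rewrite Quotient.idealrBE; apply/eqP; rewrite reprK.
have /in_ideal_squareP[s sE] : u' - u \in in_ideal_square.
  by apply/cclass_eq; rewrite /cclass reprK.
exists ((Sub (p' - p) pp, u')
         :: [seq (ideal_scale p ab.1, ab.2) | ab <- s]).
rewrite big_cons big_map /=.
under eq_bigr do rewrite /= -mulrA.
by rewrite -mulr_sumr -sE /= mulrBl mulrBr addrA subrK.
Qed.

Fact conormal_scaleA f g m :
  conormal_scale f (conormal_scale g m) = conormal_scale (f * g) m.
Proof.
rewrite -[f]reprK -[g]reprK -[m]reprK -!/(rclass _) -!/(cclass _) -rmorphM.
rewrite !conormal_scaleE; congr cclass; apply: val_inj.
by rewrite /= mulrA.
Qed.

Fact conormal_scale1 : left_id 1 conormal_scale.
Proof.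
move=> m; rewrite -[m]reprK -/(cclass _) -(rmorph1 rclass) conormal_scaleE.
by congr cclass; apply: val_inj; rewrite /= mul1r.
Qed.

Fact conormal_scaleDr : right_distributive conormal_scale +%R.
Proof.
move=> f m m'; rewrite -[f]reprK -[m]reprK -[m']reprK.
rewrite -!/(rclass _) -!/(cclass _) -raddfD !conormal_scaleE -raddfD.
by congr cclass; apply: val_inj; rewrite /= mulrDr.
Qed.

Fact conormal_scaleDl m : {morph conormal_scale^~ m : f g / f + g}.
Proof.
move=> f g; rewrite -[f]reprK -[g]reprK -[m]reprK.
rewrite -!/(rclass _) -!/(cclass _) -rmorphD !conormal_scaleE -raddfD.
by congr cclass; apply: val_inj; rewrite /= mulrDl.
Qed.

HB.instance Definition _ := GRing.Zmodule_isLmodule.Build coord_ring conormal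
  conormal_scaleA conormal_scale1 conormal_scaleDr conormal_scaleDl.

(* phi (sum_i theta_i d/dx_i), evaluated at an element of I *)
Definition der_hom (theta : 'I_n -> {mpoly K[n]}) (u : ideal_elt) : coord_ring :=
  rclass (\sum_(i < n) theta i * (val u)^`M(i)).

(* equality of the classes in T^1(X), the cokernel of phi, of two elements of *)
(* Hom(I/I^2, K[X])                                                           *)
Definition T1_eq (m m' : {scalar conormal}) :=
  exists theta, forall u, m (cclass u) - m' (cclass u) = der_hom theta u.

(* B is the ring of a deformation of X over the dual numbers, emb : K -> B    *)
(* and eps : B are its structure over K[eps]/eps^2, and sp : B -> K[X] is the *)
(* quotient by eps B.  The class of m in T^1(X) represents the deformation.   *)
Definition represents (B : comNzRingType) (emb : {rmorphism K -> B}) (eps : B)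
    (sp : {rmorphism B -> coord_ring}) (m : {scalar conormal}) :=
  forall xt : 'I_n -> B, (forall i, sp (xt i) = rclass 'X_i) ->
  exists2 m' : {scalar conormal},
    (forall (u : ideal_elt) (g' : {mpoly K[n]}), m' (cclass u) = rclass g' ->
       mmap emb xt (val u) = eps * mmap emb xt g') &
    T1_eq m m'.

End CoordinateRing.
End Zariski.

Section Flat.
Variables (A B : comNzRingType) (f : {rmorphism A -> B}).

Definition bilinear_map (N P : lmodType A) (beta : N -> B -> P) :=
  [/\ forall b, linear (beta^~ b),
      forall u, {morph beta u : b b' / b + b'} &
      forall u a b, beta u (f a * b) = a *: beta u b].

(* The sum of the u (x) b, for (u, b) in s, is zero in the tensor product of  *)
(* N and B over A, by the universal property of the latter.                   *)
Definition tensor_null (N : lmodType A) (s : seq (N * B)) :=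
  forall (P : lmodType A) (beta : N -> B -> P), bilinear_map beta ->
    \sum_(ub <- s) beta ub.1 ub.2 = 0.

Definition flat :=
  forall (N N' : lmodType A) (j : {linear N -> N'}), injective j ->
  forall s : seq (N * B),
    tensor_null [seq (j ub.1, ub.2) | ub <- s] -> tensor_null s.

End Flat.

Section Deformation.
Variables (K : closedFieldType) (n : nat).

(* the image of a polynomial under K[x_1..x_n] -> K[xi, x_1..x_n] *)
Definition lift_poly (p : {mpoly K[n]}) : {mpoly K[n.+1]} :=
  p \mPo [tuple 'X_(lift ord0 i) | i < n].

(* f(0, x_1, .., x_n) *)
Definition restr0 (f : {mpoly K[n.+1]}) : {mpoly K[n]} :=
  f \mPo [tuple oapp (fun j => 'X_j) 0 (unlift ord0 i) | i < n.+1].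
HB.instance Definition _ := GRing.RMorphism.copy restr0
  (comp_mpoly [tuple oapp (fun j => 'X_j) 0 (unlift ord0 i) | i < n.+1]).

Lemma restr0E f x : (restr0 f).@[x] = f.@[pcons 0 x].
Proof.
rewrite comp_mpoly_meval; apply: meval_eq => i; rewrite !tnth_mktuple /pcons.
by case: unliftP => [j|] _ /=; rewrite ?mevalXU ?meval0.
Qed.

Definition xi (S : variety K n.+1) : coord_ring S := rclass S 'X_ord0.

(* the comorphism of xi : S -> K *)
Definition xi_comorphism (S : variety K n.+1) : {poly K} -> coord_ring S :=
  rclass S \o horner_alg ('X_ord0 : {mpoly K[n.+1]}).
HB.instance Definition _ S := GRing.RMorphism.copy (xi_comorphism S)
  (rclass S \o horner_alg ('X_ord0 : {mpoly K[n.+1]})).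

(* a deformation of X over the affine line, embedded in the product of this   *)
(* line (the coordinate ord0) with the affine space containing X              *)
Structure deformation (X : variety K n) := Deformation {
  total :> variety K n.+1;
  deformation_flat : flat (xi_comorphism total);
  (* the ideal of the scheme-theoretic fiber is that of {0} * X *)
  deformation_fiber : forall f : {mpoly K[n.+1]},
    (exists2 j, j \in vanishing total & exists r, f = j + 'X_ord0 * r) <->
    (forall x, carrier X x -> f.@[pcons 0 x] = 0) }.

Section DoublePoint.
Variables (X : variety K n) (S : deformation X).

Definition xi2_ideal : {pred coord_ring S} :=
  fun f => `[< exists r, f = r * xi S ^+ 2 >].

Lemma xi2_idealP f :
  reflect (exists r, f = r * xi S ^+ 2) (f \in xi2_ideal).
Proof. exact: asboolP. Qed.

Lemma restr0_vanishing f : f \in vanishing S -> restr0 f \in vanishing X.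
Proof.
move=> Sf; apply/vanishingP => x Xx; rewrite restr0E.
move: x Xx; apply: (deformation_fiber S f).1; exists f => //.
by exists 0; rewrite mulr0 addr0.
Qed.

(* the restriction K[S] -> K[X] *)
Definition fiber_restr (f : coord_ring S) : coord_ring X :=
  rclass X (restr0 (repr f)).

Lemma fiber_restrE p : fiber_restr (rclass S p) = rclass X (restr0 p).
Proof.
apply/eqP; rewrite -Quotient.idealrBE -rmorphB restr0_vanishing //.
by rewrite Quotient.idealrBE reprK.
Qed.

Fact fiber_restr_zmod : zmod_morphism fiber_restr.
Proof.
move=> f g; rewrite -[f]reprK -[g]reprK -!/(rclass _ _) -rmorphB.
by rewrite !fiber_restrE !rmorphB.
Qed.
Fact fiber_restr_monoid : monoid_morphism fiber_restr.
Proof.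
split=> [|f g]; first by rewrite -(rmorph1 (rclass S)) fiber_restrE !rmorph1.
rewrite -[f]reprK -[g]reprK -!/(rclass _ _) -rmorphM.
by rewrite !fiber_restrE !rmorphM.
Qed.
HB.instance Definition _ :=
  GRing.isZmodMorphism.Build _ _ fiber_restr fiber_restr_zmod.
HB.instance Definition _ :=
  GRing.isMonoidMorphism.Build _ _ fiber_restr fiber_restr_monoid.

Lemma fiber_restr_xi : fiber_restr (xi S) = 0.
Proof.
rewrite /xi fiber_restrE -(rmorph0 (rclass X)); apply/rclass_eq => x _.
by rewrite restr0E mevalXU /pcons unlift_none meval0.
Qed.

Fact xi2_ideal_idealr : idealr_closed xi2_ideal.
Proof.
split.
- by apply/xi2_idealP; exists 0; rewrite mul0r.
- apply/xi2_idealP => -[r /(congr1 fiber_restr)/eqP].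
  rewrite rmorph1 rmorphM rmorphXn /= fiber_restr_xi expr0n mulr0.
  by rewrite oner_eq0.
- move=> a u v /xi2_idealP[r ->] /xi2_idealP[r' ->]; apply/xi2_idealP.
  by exists (a * r + r'); rewrite mulrDl mulrA.
Qed.
HB.instance Definition _ := isIdealr.Build _ xi2_ideal xi2_ideal_idealr.

(* the ring of the restriction of S to the double point *)
Definition double_ring := {ideal_quot xi2_ideal}.
HB.instance Definition _ := GRing.ComNzRing.on double_ring.
HB.instance Definition _ := NzRingQuotient.on double_ring.

Definition double_emb : K -> double_ring :=
  \pi_double_ring \o rclass S \o @mpolyC n.+1 K.
HB.instance Definition _ := GRing.RMorphism.copy double_emb
  (\pi_double_ring \o rclass S \o @mpolyC n.+1 K).

(* eps is the restriction of the coordinate xi itself: this is the            *)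
(* identification of the double point given by the tangent vector d/dxi.      *)
Definition double_eps : double_ring := \pi_double_ring (xi S).

Definition double_sp (z : double_ring) : coord_ring X := fiber_restr (repr z).

Lemma double_spE f : double_sp (\pi_double_ring f) = fiber_restr f.
Proof.
apply/eqP; rewrite -subr_eq0 -rmorphB.
have : repr (\pi_double_ring f) - f \in xi2_ideal.
  by rewrite Quotient.idealrBE reprK.
case/xi2_idealP => r ->.
by rewrite rmorphM rmorphXn /= fiber_restr_xi expr0n mulr0.
Qed.

Fact double_sp_zmod : zmod_morphism double_sp.
Proof.
move=> z w; rewrite -[z]reprK -[w]reprK -rmorphB.
by rewrite !double_spE rmorphB.
Qed.
Fact double_sp_monoid : monoid_morphism double_sp.
Proof.
split=> [|z w]; first by rewrite -(rmorph1 (\pi_double_ring)) double_spE rmorph1.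
rewrite -[z]reprK -[w]reprK -rmorphM.
by rewrite !double_spE rmorphM.
Qed.
HB.instance Definition _ :=
  GRing.isZmodMorphism.Build _ _ double_sp double_sp_zmod.
HB.instance Definition _ :=
  GRing.isMonoidMorphism.Build _ _ double_sp double_sp_monoid.

End DoublePoint.

Variable k : nat.
Implicit Type b : n.+1.-tuple {mpoly K[k.+1]}.

Definition hyperplane0 : set (apoint K k.+1) := [set y | y ord0 = 0].

(* b restricted to y_0 = 0, followed by {0} * K^n = K^n *)
Definition restr_map b (y : apoint K k.+1) : apoint K n := ptail (poly_map b y).

(* v(x) = d_(psi x) b (d/dy_0), a tangent vector at (0, x) *)
Definition v_field b (psi : apoint K n -> apoint K k.+1) (x : apoint K n) :
    apoint K n.+1 :=
  fun i => ((tnth b i)^`M(ord0)).@[psi x].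

(* mu(g)(x) = d_(0, x) g^o (v(x)) *)
Definition dlift b psi (g : {mpoly K[n]}) (x : apoint K n) : K :=
  \sum_(i < n.+1) ((lift_poly g)^`M(i)).@[pcons 0 x] * v_field b psi x i.

End Deformation.

(* Main.v *)
(* For g in I, the polynomial g^o vanishes on the fiber of S over 0, so g^o
   = j + xi r with j in the ideal of S.  Pulling back by b gives g^o(b(y))
   = y_0 r(b(y)), and d/dy_0 at y_0 = 0 turns this into mu(g) = r
   restricted to X, which is regular on all of X; it depends only on g
   because S is integral and xi <> 0 on it.  On the double point g(x) = eps
   r(x). Any other lifts of the coordinates are x_i + eps theta_i, and by
   Taylor's formula they change r by the derivation sum_i theta_i d/dx_i,
   hence not the class in T^1(X). *)
Require Import Defs.
From HB Require Import structures.
From mathcomp Require Import all_boot all_order all_algebra.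
From mathcomp Require Import boolp classical_sets reals complex.
From mathcomp Require Import mpoly.
From mathcomp Require Import ring.

Set Implicit Arguments.
Unset Strict Implicit.
Unset Printing Implicit Defensive.

Import GRing.Theory.

Local Open Scope classical_set_scope.
Local Open Scope ring_scope.

(** * Derivations of polynomial rings and first order Taylor expansion *)

Lemma mpoly_alg_ind n (A : nzRingType) (P : {mpoly A[n]} -> Prop) :
  (forall c, P c%:MP) -> (forall i, P 'X_i) ->
  (forall p q, P p -> P q -> P (p + q)) ->
  (forall p q, P p -> P q -> P (p * q)) ->
  forall p, P p.
Proof.
move=> PC PX PD PM; elim/mpolyind => [|c m p _ _ Pp].
  by rewrite -mpolyC0; apply: PC.
apply: (PD) Pp; rewrite -mul_mpolyC; apply: (PM) (PC c) _.
rewrite mpolyXE_id; apply: big_ind => //; first by rewrite -mpolyC1.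
move=> i _; elim: (m _) => [|d IH]; first by rewrite expr0 -mpolyC1.
by rewrite exprS; apply: PM.
Qed.

Lemma mderivXU n (A : nzRingType) (i j : 'I_n) :
  ('X_j : {mpoly A[n]})^`M(i) = (j == i)%:R.
Proof.
rewrite mderivX mnm1E; case: eqP => [->|_]; last by rewrite scale0r.
by rewrite scale1r (_ : _ - _ = 0)%MM ?mpolyX0 //; apply/mnmP => l;
  rewrite mnmBE subnn mnm0E.
Qed.

(** A derivation along [phi] is determined by its values on the variables, since both sides are
    additive and obey the same Leibniz rule. Taylor's formula and the chain rule below are both
    instances. *)
Lemma mpoly_derivationE n (A B : comNzRingType)
    (phi : {rmorphism {mpoly A[n]} -> B}) (D : {mpoly A[n]} -> B) :
  {morph D : p q / p + q} -> (forall c, D c%:MP = 0) ->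
  (forall p q, D (p * q) = phi p * D q + phi q * D p) ->
  forall p, D p = \sum_(i < n) phi (p^`M(i)) * D 'X_i.
Proof.
move=> DD DC DM; elim/mpoly_alg_ind => [c|i|p q IHp IHq|p q IHp IHq].
- by rewrite DC big1 // => i _; rewrite mderivC rmorph0 mul0r.
- rewrite (bigD1 i) //= big1 ?addr0 => [|j ji].
    by rewrite mderivXU eqxx rmorph1 mul1r.
  by rewrite mderivXU eq_sym (negPf ji) rmorph0 mul0r.
- rewrite DD IHp IHq -big_split; apply: eq_bigr => i _.
  by rewrite mderivD rmorphD mulrDl.
- rewrite DM IHp IHq !mulr_sumr -big_split; apply: eq_bigr => i _.
  by rewrite mderivM rmorphD !rmorphM /=; ring.
Qed.

Lemma mmap_taylor n (A B : comNzRingType) (f : {rmorphism A -> B}) (eps : B)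
    (eps2 : eps * eps = 0) (x t xt : 'I_n -> B)
    (xtE : forall i, xt i = x i + eps * t i) p :
  mmap f xt p = mmap f x p + eps * \sum_(i < n) t i * mmap f x (p^`M(i)).
Proof.
(* The difference [D] of the two evaluations takes values in the multiples of [eps], so products of
   two of its values vanish and [D] is a derivation along [mmap f x]. *)
pose D q := mmap f xt q - mmap f x q.
have Deps q : exists s, D q = eps * s.
  rewrite /D; elim/mpoly_alg_ind: q => [c|i|q r [s qs] [s' rs]|q r [s qs] [s' rs]].
  - by exists 0; rewrite !mmapC subrr mulr0.
  - by exists (t i); rewrite !mmapX !mmap1U xtE addrC addKr.
  - by exists (s + s'); rewrite !rmorphD mulrDr -qs -rs /=; ring.
  - exists (s * mmap f xt r + mmap f x q * s').
    by rewrite !rmorphM mulrDr mulrA mulrCA -qs -rs /=; ring.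
apply/eqP; rewrite addrC -subr_eq; apply/eqP; rewrite -/(D p).
rewrite (mpoly_derivationE (phi := mmap f x) (D := D)).
- rewrite mulr_sumr; apply: eq_bigr => i _ /=.
  by rewrite /D !mmapX !mmap1U xtE; ring.
- by move=> q r; rewrite /D !rmorphD /=; ring.
- by move=> c; rewrite /D !mmapC subrr.
- move=> q r /=; have DD0 : D q * D r = 0.
    have [s ->] := Deps q; have [s' ->] := Deps r.
    by rewrite mulrACA eps2 mul0r.
  (* The added zero is the second order term [D q * D r] in the expansion of [D (q * r)]. *)
  by rewrite -[RHS]addr0 -DD0 /D !rmorphM /=; ring.
Qed.

Lemma deriv_mmap n (A : comNzRingType) (u : 'I_n -> {poly A}) p :
  (mmap polyC u p)^`() =
  \sum_(i < n) mmap polyC u (p^`M(i)) * (u i)^`().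
Proof.
rewrite (mpoly_derivationE (phi := mmap polyC u)
          (D := fun p => (mmap polyC u p)^`())).
- by apply: eq_bigr => i _; rewrite mmapX mmap1U.
- by move=> q r; rewrite /= rmorphD derivD.
- by move=> c; rewrite /= mmapC derivC.
- by move=> q r /=; rewrite rmorphM derivM /=; ring.
Qed.

Lemma horner_mmap n (A : comNzRingType) (u : 'I_n -> {poly A}) p t :
  (mmap polyC u p).[t] = p.@[fun i => (u i).[t]].
Proof.
elim/mpoly_alg_ind: p => [c|i|p q IHp IHq|p q IHp IHq].
- by rewrite mmapC hornerC mevalC.
- by rewrite mmapX mmap1U mevalXU.
- by rewrite rmorphD hornerD IHp IHq mevalD.
- by rewrite rmorphM hornerM IHp IHq mevalM.
Qed.

(** * Tangent vectors along polynomial maps *)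

(** The polynomial [1 + p] takes only the value 1; having no root over an algebraically closed
    field, it is constant. *)
Lemma closed_poly_eq0 (K : closedFieldType) (p : {poly K}) :
  (forall t, p.[t] = 0) -> p = 0.
Proof.
move=> p0; have : size (1 + p) == 1.
  apply: contraT => /closed_rootP[t].
  by rewrite rootE hornerD hornerC p0 addr0 oner_eq0.
case/size_poly1P=> c _ pc; have {}pc : p = (c - 1)%:P.
  by rewrite polyCB -pc addrC addKr.
by have := p0 0; rewrite pc hornerC => ->.
Qed.

(* Differentiate the vanishing function f (b (y + t e_l)) of t at t = 0. *)
Lemma vanishing_tangent (K : closedFieldType) n (S : variety K n) m (b : n.-tuple {mpoly K[m]})
    (bS : forall y, carrier S (poly_map b y)) f (Sf : f \in vanishing S) y l :
  \sum_(i < n) (f^`M(i)).@[poly_map b y] * ((tnth b i)^`M(l)).@[y] = 0.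
Proof.
(* [L] is the line through [y] in the direction of the [l]-th coordinate, and [c] is its image curve
   under [b]. *)
pose L j : {poly K} := (y j)%:P + 'X * (j == l)%:R%:P.
pose c i := mmap polyC L (tnth b i).
have L0 : meval (fun j => (L j).[0]) =1 meval y :> ({mpoly K[m]} -> K).
  by move=> p; apply: meval_eq => j; rewrite /L !hornerE.
have c0 : meval (fun i => (c i).[0]) =1 meval (poly_map b y)
    :> ({mpoly K[n]} -> K).
  by move=> p; apply: meval_eq => j; rewrite /c horner_mmap L0.
have fc0 : mmap polyC c f = 0.
  apply: closed_poly_eq0 => t; rewrite horner_mmap.
  have /vanishingP/(_ _ (bS (fun j => (L j).[t]))) <- := Sf.
  by apply: meval_eq => i; rewrite /c horner_mmap.
have := deriv_mmap c f; rewrite fc0 deriv0 => /(congr1 (horner^~ 0)).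
rewrite horner_sum horner0 => sum0; rewrite [RHS]sum0; apply: eq_bigr => i _.
rewrite hornerM horner_mmap c0; congr (_ * _).
rewrite /c deriv_mmap horner_sum (bigD1 l) //= big1 => [|j jl].
  by rewrite hornerM horner_mmap L0 /L !derivE eqxx !hornerE.
by rewrite hornerM horner_mmap L0 /L !derivE (negPf jl) !hornerE /= !mulr0.
Qed.

(** * Linear maps on the conormal module *)

Section Deformation.
Local Open Scope quotient_scope.
Variables (K : closedFieldType) (n : nat).

Lemma conormal_lift (X : variety K n) (f : ideal_elt X -> coord_ring X) :
  {morph f : u v / u + v} ->
  (forall p u, f (ideal_scale p u) = rclass X p * f u) ->
  exists m : {scalar conormal X}, forall u, m (cclass u) = f u.
Proof.
move=> fD fZ.
have f0 : f 0 = 0 by apply: (addrI (f 0)); rewrite -fD !addr0.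
have fsq u : u \in @in_ideal_square _ _ X -> f u = 0.
  case/in_ideal_squareP => s us.
  (* Each summand of an element of the square of the ideal is a scaling by some [val ab.1] in the
     ideal, which is zero in the coordinate ring; hence [f] kills it. *)
  have -> : u = \sum_(ab <- s) ideal_scale (val ab.1) ab.2.
    by apply: val_inj; rewrite us raddf_sum.
  rewrite (big_morph f fD f0) big1 // => ab _; rewrite fZ.
  have -> : rclass X (val ab.1) = 0; last by rewrite mul0r.
  rewrite -(rmorph0 (rclass X)); apply/rclass_eq => x Xx.
  by rewrite meval0 (vanishingP _ _ (valP ab.1)).
have fE u : f (repr (cclass u)) = f u.
  have /cclass_eq/fsq fru : cclass (repr (cclass u)) = cclass u.
    by rewrite /cclass reprK.
  by rewrite -{1}[repr _](subrK u) fD fru add0r.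
pose m (c : conormal X) : coord_ring X := f (repr c).
have m_lin : linear_for *%R m.
  move=> a c d; rewrite -[a]reprK -[c]reprK -[d]reprK.
  rewrite -/(rclass X _) -!/(cclass _) /m.
  have -> : rclass X (repr a) *: cclass (repr c)
      = cclass (ideal_scale (repr a) (repr c)) by exact: conormal_scaleE.
  by rewrite -raddfD !fE fD fZ.
pose mL := GRing.isLinear.Build _ _ _ _ m m_lin.
by exists (HB.pack_for {scalar conormal X} m mL) => u; apply: fE.
Qed.

Lemma der_homD (X : variety K n) theta :
  {morph @der_hom _ _ X theta : u v / u + v}.
Proof.
move=> u v; rewrite /der_hom -rmorphD -big_split; congr rclass.
by apply: eq_bigr => i _; rewrite /= mderivD mulrDr.
Qed.

(** In the Leibniz rule, the terms that differentiate [p] carry the factor [u], which vanishes on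
    [X]. *)
Lemma der_homZ (X : variety K n) theta p (u : ideal_elt X) :
  der_hom theta (ideal_scale p u) = rclass X p * der_hom theta u.
Proof.
rewrite /der_hom -rmorphM; apply/rclass_eq => x Xx.
have u0 := vanishingP _ _ (valP u) x Xx.
rewrite mevalM !raddf_sum mulr_sumr; apply: eq_bigr => i _ /=.
by rewrite !mevalM mderivM mevalD !mevalM u0; ring.
Qed.

(** * The restriction of the deformation to the double point *)

Variables (X : variety K n) (S : deformation X).

Lemma lift_polyE (p : {mpoly K[n]}) z : (lift_poly p).@[z] = p.@[ptail z].
Proof.
rewrite comp_mpoly_meval; apply: meval_eq => i.
by rewrite tnth_mktuple mevalXU.
Qed.

Lemma lift_polyXU i : lift_poly 'X_i = 'X_(lift ord0 i) :> {mpoly K[n.+1]}.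
Proof. by rewrite /lift_poly comp_mpolyXU -tnth_nth tnth_mktuple. Qed.

Lemma restr0_lift_poly (p : {mpoly K[n]}) :
  rclass X (restr0 (lift_poly p)) = rclass X p.
Proof.
apply/rclass_eq => x _; rewrite restr0E lift_polyE.
by apply: meval_eq => i; rewrite /ptail /pcons liftK.
Qed.

(** This is where the scheme-theoretic fiber condition enters; it yields both the slope of an
    equation and the comparison of two lifts of a coordinate. *)
Lemma rclass_restr0_eq0 f : rclass X (restr0 f) = 0 ->
  exists r, rclass S f = xi S * rclass S r.
Proof.
move=> f0.
have [|j Sj [r ->]] := (deformation_fiber S f).2.
  have /rclass_eq f0X : rclass X (restr0 f) = rclass X 0 by rewrite f0 rmorph0.
  by move=> x /f0X; rewrite restr0E meval0.
exists r; rewrite rmorphD rmorphM /=.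
suff -> : rclass S j = 0 by rewrite add0r.
rewrite -(rmorph0 (rclass S)); apply/rclass_eq => x Sx.
by rewrite meval0 (vanishingP _ _ Sj).
Qed.

Lemma double_ringP (z : double_ring S) :
  exists p, z = \pi_(double_ring S) (rclass S p).
Proof. by exists (repr (repr z)); rewrite /rclass !reprK. Qed.

Lemma double_eps2 : double_eps S * double_eps S = 0.
Proof.
rewrite -rmorphM -(rmorph0 (\pi_(double_ring S))).
apply/eqP; rewrite -Quotient.idealrBE subr0.
by apply/xi2_idealP; exists 1; rewrite mul1r expr2.
Qed.

Lemma double_sp_eq (z w : double_ring S) : double_sp z = double_sp w ->
  exists r, z = w + double_eps S * \pi_(double_ring S) (rclass S r).
Proof.
move=> zw; have [p pE] := double_ringP (z - w).
have [|r rE] := @rclass_restr0_eq0 p.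
  by rewrite -(fiber_restrE S) -double_spE -pE rmorphB /= zw subrr.
exists r; have <- : z - w = double_eps S * \pi_(double_ring S) (rclass S r).
  by rewrite pE rE rmorphM.
by rewrite addrC subrK.
Qed.

(** Since [eps] squares to zero, multiplication by it factors through the coordinate ring of [X]. *)
Lemma double_eps_eq (z w : double_ring S) : double_sp z = double_sp w ->
  double_eps S * z = double_eps S * w.
Proof.
by case/double_sp_eq => r ->; rewrite mulrDr mulrA double_eps2 mul0r addr0.
Qed.

Lemma double_sp_mmap (xt : 'I_n -> double_ring S)
    (xtP : forall i, double_sp (xt i) = rclass X 'X_i) p :
  double_sp (mmap (double_emb S) xt p) = rclass X p.
Proof.
elim/mpoly_alg_ind: p => [c|i|p q IHp IHq|p q IHp IHq].
- rewrite mmapC /double_emb /= double_spE fiber_restrE.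
  by apply/rclass_eq => x _; rewrite restr0E !mevalC.
- by rewrite mmapX mmap1U.
- by rewrite !rmorphD /= IHp IHq.
- by rewrite !rmorphM /= IHp IHq.
Qed.

Definition double_coord i : double_ring S :=
  \pi_(double_ring S) (rclass S 'X_(lift ord0 i)).

Lemma double_sp_coord i : double_sp (double_coord i) = rclass X 'X_i.
Proof.
by rewrite double_spE fiber_restrE -lift_polyXU restr0_lift_poly.
Qed.

Lemma mmap_double_coord p :
  mmap (double_emb S) double_coord p
    = \pi_(double_ring S) (rclass S (lift_poly p)).
Proof.
rewrite /lift_poly; elim/mpoly_alg_ind: p => [c|i|p q IHp IHq|p q IHp IHq].
- by rewrite mmapC comp_mpolyC.
- by rewrite mmapX mmap1U -/(lift_poly _) lift_polyXU.
- by rewrite !rmorphD /= IHp IHq.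
- by rewrite !rmorphM /= IHp IHq.
Qed.

(** Behind a factor [eps] only the restriction to [X] matters, so [r i] may be replaced by
    [restr0 (r i)], a polynomial in the coordinates of [X] alone. *)
Lemma mmap_double_taylor (xt : 'I_n -> double_ring S) (r : 'I_n -> {mpoly K[n.+1]})
    (xtE : forall i, xt i =
       double_coord i + double_eps S * \pi_(double_ring S) (rclass S (r i))) p :
  mmap (double_emb S) xt p = mmap (double_emb S) double_coord p + double_eps S *
    mmap (double_emb S) double_coord (\sum_(i < n) restr0 (r i) * p^`M(i)).
Proof.
rewrite (mmap_taylor _ double_eps2 xtE) rmorph_sum !mulr_sumr.
congr (_ + _); apply: eq_bigr => i _; rewrite rmorphM !mulrA; congr (_ * _).
apply: double_eps_eq.
by rewrite (double_sp_mmap double_sp_coord) double_spE fiber_restrE.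
Qed.

(** * The slope of an equation along the family [b] *)

Variables (k : nat) (b : n.+1.-tuple {mpoly K[k.+1]}).
Hypotheses (bS : forall y, carrier S (poly_map b y)).
Hypotheses (xi_b : tnth b ord0 = 'X_ord0).

Lemma xi_neq0 : xi S != 0.
Proof.
apply/eqP; rewrite /xi -(rmorph0 (rclass S)).
(* At the image under [b] of the point with all coordinates 1, the function [xi] equals 1. *)
move=> /rclass_eq/(_ _ (bS (fun=> 1)))/eqP.
by rewrite mevalXU /poly_map xi_b mevalXU meval0 oner_eq0.
Qed.

Lemma dlift_slope psi x g r : (psi x) ord0 = 0 -> restr_map b (psi x) = x ->
  rclass S (lift_poly g) = xi S * rclass S r ->
  dlift b psi g x = (restr0 r).@[x].
Proof.
move=> psi0 psix; rewrite /xi -rmorphM => /rclass_eq gr.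
have bpsi : poly_map b (psi x) = pcons 0 x.
  apply/funext => i; rewrite /pcons; case: unliftP => [j ->|->] /=.
    by rewrite -[in RHS]psix.
  by rewrite /poly_map xi_b mevalXU psi0.
have Sf : lift_poly g - 'X_ord0 * r \in vanishing S.
  by apply/vanishingP => z Sz; rewrite mevalB gr // subrr.
(* The vector [v] is tangent to [S], so the differentials of the lifted [g] and of [xi * r] agree on
   it. At [xi = 0] the latter reduces to [r] times the first component of [v], which is 1 by
   [xi_b]. *)
have := vanishing_tangent bS Sf (psi x) ord0; rewrite bpsi.
under eq_bigr => i _ do rewrite mderivB mevalB mulrBl.
rewrite sumrB => /eqP; rewrite subr_eq0 => /eqP; rewrite /dlift => ->.
have pc0 : pcons 0 x ord0 = 0 by rewrite /pcons unlift_none.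
rewrite restr0E (bigD1 ord0) //= big1 => [|i i0].
  rewrite xi_b mderivM !mderivXU eqxx mul1r.
  by rewrite mevalD mevalM mevalXU pc0 mul0r meval1 !addr0 mulr1.
rewrite mderivM mderivXU eq_sym (negPf i0) mul0r add0r.
by rewrite mevalM mevalXU pc0 !mul0r.
Qed.

Lemma slope_hom : exists mu : {scalar conormal X},
  forall u : ideal_elt X, exists2 r, mu (cclass u) = rclass X (restr0 r) &
    rclass S (lift_poly (val u)) = xi S * rclass S r.
Proof.
have slope (u : ideal_elt X) :
    exists r, rclass S (lift_poly (val u)) = xi S * rclass S r.
  apply: rclass_restr0_eq0; rewrite restr0_lift_poly -(rmorph0 (rclass X)).
  by apply/rclass_eq => x Xx; rewrite meval0 (vanishingP _ _ (valP u)).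
have [r rP] := choice slope.
(* Cancelling [xi] shows that the slope is unique on [X], so arbitrarily chosen slopes [r] still
   form a linear map. *)
have slope_inj p q : xi S * rclass S p = xi S * rclass S q ->
    rclass X (restr0 p) = rclass X (restr0 q).
  by move/(mulfI xi_neq0) => pq; rewrite -!(fiber_restrE S) pq.
have [||mu muE] := @conormal_lift X (fun u => rclass X (restr0 (r u))).
- move=> u v; rewrite /= -!rmorphD; apply: slope_inj.
  by rewrite -rP !rmorphD mulrDr -!rP -rmorphD -[lift_poly _ + _]rmorphD.
- move=> p u; rewrite /= -(restr0_lift_poly p) -!rmorphM; apply: slope_inj.
  by rewrite -rP rmorphM mulrCA -rP -rmorphM -[lift_poly _ * _]rmorphM.
- by exists mu => u; exists (r u); rewrite ?muE ?rP.
Qed.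

Lemma slope_represents (mu : {scalar conormal X}) :
  (forall u : ideal_elt X, exists2 r, mu (cclass u) = rclass X (restr0 r) &
     rclass S (lift_poly (val u)) = xi S * rclass S r) ->
  represents (double_emb S) (double_eps S) (@double_sp _ _ _ S) mu.
Proof.
move=> muP xt xtP.
have xtE i : exists r, xt i =
    double_coord i + double_eps S * \pi_(double_ring S) (rclass S r).
  by apply: double_sp_eq; rewrite [RHS]double_sp_coord -xtP.
have [r rE] := choice xtE.
pose theta i := restr0 (r i).
(* By Taylor's formula, passing from the standard lifts to [xt] adds the derivation [theta] to the
   slope. *)
have [||m' m'E] := @conormal_lift X (fun u => mu (cclass u) + der_hom theta u).
- by move=> u v; rewrite /= raddfD raddfD der_homD addrACA.
- move=> p u; rewrite /= der_homZ mulrDr; congr (_ + _); rewrite -scalarZ.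
  by congr (mu _); rewrite -conormal_scaleE.
exists m' => [u g'|]; last first.
  (* [T1_eq] compares [mu - m'], hence the sign. *)
  exists (fun i => - theta i) => u; rewrite m'E opprD addNKr /der_hom -rmorphN.
  by rewrite -sumrN; congr rclass; apply: eq_bigr => i _; rewrite mulNr.
have [s musu us] := muP u.
rewrite m'E musu => g'E.
rewrite (mmap_double_taylor rE) [X in X + _]mmap_double_coord us.
rewrite rmorphM -mulrDr; apply: double_eps_eq.
rewrite rmorphD /= double_spE fiber_restrE (double_sp_mmap double_sp_coord).
by rewrite (double_sp_mmap xtP) -g'E.
Qed.

End Deformation.

(** * Regularity of [mu] and its class over the complex numbers *)

Theorem proposition6p16 (R : realType) (n k : nat)
    (X : variety R[i] n) (normal_X : normal X)
    (S : deformation X)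
    (b : n.+1.-tuple {mpoly R[i][k.+1]})
    (dominant_b : dominant [set: apoint R[i] k.+1] (poly_map b) (carrier S))
    (xi_b : tnth b ord0 = 'X_ord0)
    (dominant_b0 : dominant (@hyperplane0 R[i] k) (restr_map b) (carrier X))
    (birational_b0 : birational (@hyperplane0 R[i] k) (restr_map b) (carrier X))
    (U : set (apoint R[i] n))
    (open_U : zopen_in (carrier X) U)
    (smooth_U : forall x, U x -> smooth_at X x)
    (codim_U : codim_ge (carrier X) (carrier X `\` U) 2)
    (U' : set (apoint R[i] n)) (sub_U' : U' `<=` U)
    (psi : apoint R[i] n -> apoint R[i] k.+1)
    (inverse_b0 :
       inverse_on (@hyperplane0 R[i] k) (restr_map b) (carrier X) U' psi) :
  (forall g, g \in vanishing X ->
     exists h : coord_ring X,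
       forall x, U' x -> reval h x = dlift b psi g x) /\
  (exists mu : {scalar conormal X},
     (forall (g : ideal_elt X) x, U' x ->
        reval (mu (cclass g)) x = dlift b psi (val g) x) /\
     represents (double_emb S) (double_eps S) (@double_sp _ _ _ S) mu).
Proof.
have bS y : carrier S (poly_map b y) by apply: dominant_b.1; exists y.
have [mu muP] := slope_hom bS xi_b.
have muE (g : ideal_elt X) x : U' x ->
    reval (mu (cclass g)) x = dlift b psi (val g) x.
  move=> U'x; have [[Z _ U'E] _ _ psiP _] := inverse_b0.
  have Xx : carrier X x by move: U'x; rewrite U'E => -[].
  have [psi0 psix] := psiP x U'x; have [r -> rP] := muP g.
  by rewrite reval_rclass // (dlift_slope bS xi_b psi0 psix rP).
(* The value of [mu] on the class of [g] is itself the regular extension required in the first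
   claim. *)
split=> [g Xg|]; first by exists (mu (cclass (Sub g Xg))) => x /muE.
by exists mu; split=> //; apply: slope_represents.
Qed.
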